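(* Let $\mathcal{X}$ be a finite set with $|\mathcal{X}|\geq 2$. Then the total-variation topology $\mathcal{T}_{TV,\mathcal{X},\ast}^{(o)}$ on $\mathrm{DMC}_{\mathcal{X},\ast}^{(o)}$ is not a natural topology.
   Context: For finite nonempty sets $\mathcal{X},\mathcal{Y}$, $\mathrm{DMC}_{\mathcal{X},\mathcal{Y}}$ is the set of channels from $\mathcal{X}$ to $\mathcal{Y}$, i.e. functions $W:\mathcal{X}\times\mathcal{Y}\to[0,1]$, written $W(y|x)$, with $\sum_{y\in\mathcal{Y}}W(y|x)=1$ for every $x\in\mathcal{X}$. It carries the topology inherited from the Euclidean topology of $\mathbb{R}^{\mathcal{X}\times\mathcal{Y}}$. For $W\in\mathrm{DMC}_{\mathcal{X},\mathcal{Y}}$ and $V\in\mathrm{DMC}_{\mathcal{Y},\mathcal{Z}}$, the composition $V\circ W\in\mathrm{DMC}_{\mathcal{X},\mathcal{Z}}$ is $(V\circ W)(z|x)=\sum_{y\in\mathcal{Y}}V(z|y)W(y|x)$. A channel $W'\in\mathrm{DMC}_{\mathcal{X},\mathcal{Z}}$ is degraded from $W\in\mathrm{DMC}_{\mathcal{X},\mathcal{Y}}$ if $W'=V\circ W$ for some $V\in\mathrm{DMC}_{\mathcal{Y},\mathcal{Z}}$; $W$ and $W'$ are equivalent if each is degraded from the other. $\mathrm{DMC}_{\mathcal{X},\mathcal{Y}}^{(o)}$ is the quotient of $\mathrm{DMC}_{\mathcal{X},\mathcal{Y}}$ by this equivalence relation, with the quotient topology $\mathcal{T}_{\mathcal{X},\mathcal{Y}}^{(o)}$.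 Let $[n]=\{1,\dots,n\}$, let $\mathrm{DMC}_{\mathcal{X},\ast}=\coprod_{n\ge1}\mathrm{DMC}_{\mathcal{X},[n]}$, and let $\mathrm{DMC}_{\mathcal{X},\ast}^{(o)}$ be the quotient set of $\mathrm{DMC}_{\mathcal{X},\ast}$ by equivalence of channels. For each $n\geq 1$, $\mathrm{DMC}_{\mathcal{X},[n]}^{(o)}$ is identified with the subset of $\mathrm{DMC}_{\mathcal{X},\ast}^{(o)}$ consisting of the classes containing a channel with output alphabet $[n]$; these subsets increase with $n$ and their union is $\mathrm{DMC}_{\mathcal{X},\ast}^{(o)}$. A topology on $\mathrm{DMC}_{\mathcal{X},\ast}^{(o)}$ is called natural if for every $n\ge1$ the subspace topology it induces on $\mathrm{DMC}_{\mathcal{X},[n]}^{(o)}$ is $\mathcal{T}_{\mathcal{X},[n]}^{(o)}$. Let $\Delta_{\mathcal{X}}$ be the simplex of probability distributions on $\mathcal{X}$. For $W\in\mathrm{DMC}_{\mathcal{X},\mathcal{Y}}$, put $P_W^o(y)=\frac1{|\mathcal{X}|}\sum_{x}W(y|x)$, $\mathrm{Im}(W)=\{y:P_W^o(y)>0\}$, and for $y\in\mathrm{Im}(W)$ let $W_y^{-1}\in\Delta_{\mathcal{X}}$ be $W_y^{-1}(x)=W(y|x)/(|\mathcal{X}|P_W^o(y))$. The Blackwell measure of $W$ is the Borel probability measure $\mathrm{MP}_W=\sum_{y\in\mathrm{Im}(W)}P_W^o(y)\,\delta_{W_y^{-1}}$ on $\Delta_{\mathcal{X}}$. It is known that two channels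 with input alphabet $\mathcal{X}$ are equivalent if and only if they have the same Blackwell measure, so $\mathrm{MP}_{\hat W}$ is defined for $\hat W\in\mathrm{DMC}_{\mathcal{X},\ast}^{(o)}$ and determines $\hat W$. The total-variation topology $\mathcal{T}_{TV,\mathcal{X},\ast}^{(o)}$ is induced by the metric $d_{TV,\mathcal{X},\ast}^{(o)}(\hat W,\hat W')=\|\mathrm{MP}_{\hat W}-\mathrm{MP}_{\hat W'}\|_{TV}=\sup_{B}|\mathrm{MP}_{\hat W}(B)-\mathrm{MP}_{\hat W'}(B)|$, the supremum being over Borel sets $B\subset\Delta_{\mathcal{X}}$. *)

(* Defs.v *)
From HB Require Import structures.
From mathcomp Require Import all_boot all_order all_algebra.
From mathcomp Require Import generic_quotient.
From mathcomp Require Import all_classical all_reals all_analysis.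
From mathcomp Require Import lra.

Set Implicit Arguments.
Unset Strict Implicit.
Unset Printing Implicit Defensive.

Import Order.TTheory GRing.Theory Num.Theory.
Import numFieldNormedType.Exports.

Local Open Scope classical_set_scope.
Local Open Scope ring_scope.
Local Open Scope quotient_scope.

Section channels.
Context (R : realType).
Implicit Types X Y Z : finType.

(* {ptws X * Y -> R} carries the product topology, which is the Euclidean
   topology as X * Y is finite, and a set coerced to a type carries the
   subspace topology. *)
Definition channel X Y : Type :=
  [set W : {ptws X * Y -> R} | (forall xy, 0 <= W xy <= 1) /\
                               (forall x, \sum_(y : Y) W (x, y) = 1)].
HB.instance Definition _ X Y := Topological.on (channel X Y).

(* kern W x y stands for W(y|x). *)
Definition kern X Y (W : channel X Y) (x : X) (y : Y) : R := set_val W (x, y).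

Lemma kernP X Y (W : channel X Y) :
  (forall x y, 0 <= kern W x y <= 1) /\ (forall x, \sum_y kern W x y = 1).
Proof. by have [W01 W1] := set_valP W; split => // x y; exact: W01. Qed.

Lemma kern_inj X Y (W W' : channel X Y) : kern W = kern W' -> W = W'.
Proof.
move=> e; apply: val_inj; apply/funext => -[x y].
exact: (congr1 (fun k => k x y) e).
Qed.

Definition mk_channel X Y (k : X -> Y -> R) (k0 : forall x y, 0 <= k x y)
    (k1 : forall x, \sum_y k x y = 1) : channel X Y.
Proof.
exists (fun xy => k xy.1 xy.2); apply/mem_set; split => [[x y]|x] /=; last exact: k1.
rewrite k0 -(k1 x) (bigD1 y)//= lerDl; exact: sumr_ge0.
Defined.

Lemma kern_mk X Y (k : X -> Y -> R) k0 k1 : kern (@mk_channel X Y k k0 k1) = k.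
Proof. by []. Qed.

Definition comp_kern X Y Z (V : channel Y Z) (W : channel X Y) (x : X) (z : Z) : R :=
  \sum_(y : Y) kern V y z * kern W x y.

Lemma comp_kern_ge0 X Y Z (V : channel Y Z) (W : channel X Y) x z :
  0 <= comp_kern V W x z.
Proof.
apply: sumr_ge0 => y _; apply: mulr_ge0.
  by have /andP[] := (kernP V).1 y z.
by have /andP[] := (kernP W).1 x y.
Qed.

Lemma comp_kern_sum X Y Z (V : channel Y Z) (W : channel X Y) x :
  \sum_z comp_kern V W x z = 1.
Proof.
rewrite exchange_big/= -((kernP W).2 x); apply: eq_bigr => y _.
by rewrite -mulr_suml (kernP V).2 mul1r.
Qed.

Definition comp_channel X Y Z (V : channel Y Z) (W : channel X Y) : channel X Z :=
  mk_channel (comp_kern_ge0 V W) (comp_kern_sum V W).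

Definition degraded X Y Z (W' : channel X Z) (W : channel X Y) : Prop :=
  exists V : channel Y Z, W' = comp_channel V W.

Definition channel_equiv X Y Z (W : channel X Y) (W' : channel X Z) : Prop :=
  degraded W W' /\ degraded W' W.

Lemma degraded_refl X Y (W : channel X Y) : degraded W W.
Proof.
have k0 (y z : Y) : 0 <= (y == z)%:R :> R by exact: ler0n.
have sumE (f : Y -> R) z : \sum_y (y == z)%:R * f y = f z.
  rewrite (bigD1 z)//= eqxx mul1r big1 ?addr0// => y /negbTE ->.
  by rewrite mul0r.
have k1 (y : Y) : \sum_z (y == z)%:R = 1 :> R.
  rewrite -[RHS](sumE (fun=> 1) y); apply: eq_bigr => z _.
  by rewrite mulr1 eq_sym.
exists (mk_channel k0 k1); apply: kern_inj; apply/funext => x; apply/funext => z.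
by rewrite kern_mk /comp_kern kern_mk sumE.
Qed.

Lemma degraded_trans X Y Z T (W : channel X Y) (W' : channel X Z)
    (W'' : channel X T) :
  degraded W' W -> degraded W'' W' -> degraded W'' W.
Proof.
move=> [V ->] [V' ->]; exists (comp_channel V' V).
apply: kern_inj; apply/funext => x; apply/funext => t.
rewrite !kern_mk /comp_kern.
under eq_bigr => z _ do rewrite kern_mk mulr_sumr.
rewrite exchange_big/=; apply: eq_bigr => y _.
by rewrite kern_mk mulr_suml; apply: eq_bigr => z _; rewrite mulrA.
Qed.

Lemma channel_equiv_refl X Y (W : channel X Y) : channel_equiv W W.
Proof. by split; exact: degraded_refl. Qed.

Lemma channel_equiv_sym X Y Z (W : channel X Y) (W' : channel X Z) :
  channel_equiv W W' -> channel_equiv W' W.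
Proof. by case. Qed.

Lemma channel_equiv_trans X Y Z T (W : channel X Y) (W' : channel X Z)
    (W'' : channel X T) :
  channel_equiv W W' -> channel_equiv W' W'' -> channel_equiv W W''.
Proof.
by move=> [a b] [c d]; split; [exact: degraded_trans c a|exact: degraded_trans b d].
Qed.

Section fixed_output.
Variables X Y : finType.

Definition equiv_fixed (W W' : channel X Y) : bool := `[< channel_equiv W W' >].

Lemma equiv_fixed_refl : reflexive equiv_fixed.
Proof. by move=> W; apply/asboolP; exact: channel_equiv_refl. Qed.

Lemma equiv_fixed_sym : symmetric equiv_fixed.
Proof.
by move=> W W'; apply/asboolP/asboolP => /channel_equiv_sym.
Qed.

Lemma equiv_fixed_trans : transitive equiv_fixed.
Proof.
move=> W' W W'' /asboolP a /asboolP b; apply/asboolP.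
exact: channel_equiv_trans a b.
Qed.

Canonical equiv_fixed_equiv :=
  EquivRel equiv_fixed equiv_fixed_refl equiv_fixed_sym equiv_fixed_trans.

Definition dmco : Type := quotient_topology {eq_quot equiv_fixed}.
HB.instance Definition _ := Topological.on dmco.
HB.instance Definition _ := Quotient.on dmco.

End fixed_output.

Section any_output.
Variable X : finType.

(* The output alphabet [n] with n >= 1 is rendered as 'I_n.+1 with n : nat. *)
Definition channel_star : Type := {n : nat & channel X 'I_n.+1}.
HB.instance Definition _ := Choice.on channel_star.

Definition equiv_star (W W' : channel_star) : bool :=
  `[< channel_equiv (projT2 W) (projT2 W') >].

Lemma equiv_star_refl : reflexive equiv_star.
Proof. by move=> W; apply/asboolP; exact: channel_equiv_refl. Qed.

Lemma equiv_star_sym : symmetric equiv_star.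
Proof.
by move=> W W'; apply/asboolP/asboolP => /channel_equiv_sym.
Qed.

Lemma equiv_star_trans : transitive equiv_star.
Proof.
move=> W' W W'' /asboolP a /asboolP b; apply/asboolP.
exact: channel_equiv_trans a b.
Qed.

Canonical equiv_star_equiv :=
  EquivRel equiv_star equiv_star_refl equiv_star_sym equiv_star_trans.

Definition dmco_star : Type := {eq_quot equiv_star}.
HB.instance Definition _ := Choice.on dmco_star.
HB.instance Definition _ := Quotient.on dmco_star.

(* The identification of the quotient for the output alphabet [n + 1] with the
   set of classes that contain a channel with this output alphabet. *)
Definition dmco_incl (n : nat) (w : dmco X 'I_n.+1) : dmco_star :=
  \pi_dmco_star (existT (fun n : nat => channel X 'I_n.+1) n (repr w)).

Lemma dmco_incl_pi n (W : channel X 'I_n.+1) :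
  dmco_incl (\pi_(dmco X 'I_n.+1) W) =
  \pi_dmco_star (existT (fun n : nat => channel X 'I_n.+1) n W).
Proof.
apply/eqmodP/asboolP => /=.
have e : \pi_{eq_quot (@equiv_fixed X 'I_n.+1)}
    (repr (\pi_(dmco X 'I_n.+1) W)) = \pi W by exact: reprK.
by move/eqmodP/asboolP : e.
Qed.

Lemma dmco_incl_inj n : injective (@dmco_incl n).
Proof.
move=> w w' /eqmodP/asboolP/= e; rewrite -[w]reprK -[w']reprK.
by apply/eqmodP/asboolP.
Qed.

Lemma range_dmco_incl n : range (@dmco_incl n) =
  [set w | exists W : channel X 'I_n.+1,
     w = \pi_dmco_star (existT (fun n : nat => channel X 'I_n.+1) n W)].
Proof.
apply/seteqP; split => [_ [w _ <-]|_ [W ->]] /=; first by exists (repr w).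
by exists (\pi_(dmco X 'I_n.+1) W) => //; exact: dmco_incl_pi.
Qed.

(* The subspace topology is pulled back along the injection dmco_incl. *)
Definition natural_topology (tau : Topological dmco_star) : Prop :=
  forall n : nat, @open (dmco X 'I_n.+1) =
    @open (initial_topology
             (@dmco_incl n : dmco X 'I_n.+1 -> Topological.Pack tau)).

End any_output.

Section blackwell.
Variables (X : finType) (hX : (0 < #|X|)%N).

(* The proof hX is only used to make the simplex a pointed type, as required
   of measurable types. *)
Definition simplex of (0 < #|X|)%N : Type :=
  [set p : {ptws X -> R} | (forall x, 0 <= p x) /\ \sum_(x : X) p x = 1].
HB.instance Definition _ := Topological.on (simplex hX).

Definition simplex_point : simplex hX.
Proof.
exists (fun x => (x == enum_val (Ordinal hX))%:R); apply/mem_set; split => [x|].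
  exact: ler0n.
rewrite (bigD1 (enum_val (Ordinal hX)))//= eqxx big1 ?addr0// => x /negbTE ->.
by [].
Defined.

HB.instance Definition _ := isPointed.Build (simplex hX) simplex_point.

Definition borel_simplex : Type := g_sigma_algebraType (@open (simplex hX)).
HB.instance Definition _ := Measurable.on borel_simplex.

Section measure_of_channel.
Variables (Y : finType) (W : channel X Y).

Definition out_prob (y : Y) : R := #|X|%:R^-1 * \sum_(x : X) kern W x y.

Lemma out_prob_ge0 y : 0 <= out_prob y.
Proof.
rewrite mulr_ge0 ?invr_ge0 ?ler0n//; apply: sumr_ge0 => x _.
by have /andP[] := (kernP W).1 x y.
Qed.

Lemma cardX_neq0 : #|X|%:R != 0 :> R.
Proof. by rewrite pnatr_eq0 -lt0n. Qed.

Lemma out_prob_sum : \sum_y out_prob y = 1.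
Proof.
rewrite -mulr_sumr exchange_big/=.
under eq_bigr do rewrite (kernP W).2.
by rewrite sumr_const mulVf ?cardX_neq0.
Qed.

Definition channel_im : Type := {y : Y | 0 < out_prob y}.
HB.instance Definition _ := Finite.on channel_im.

Definition posterior (y : channel_im) : borel_simplex.
Proof.
exists (fun x => kern W x (val y) / (#|X|%:R * out_prob (val y))).
apply/mem_set; split => [x|].
  apply: divr_ge0; first by have /andP[] := (kernP W).1 x (val y).
  by rewrite mulr_ge0 ?ler0n ?out_prob_ge0.
rewrite -mulr_suml /out_prob mulVKf ?cardX_neq0// divff//.
by apply: contraTneq (valP y) => e; rewrite /out_prob e mulr0 ltxx.
Defined.

Definition blackwell (B : set borel_simplex) : \bar R :=
  (\sum_(y : channel_im) (out_prob (val y))%:E * \d_(posterior y) B)%E.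

Lemma blackwell_term_ge0 (y : channel_im) (B : set borel_simplex) :
  (0 <= (out_prob (val y))%:E * \d_(posterior y) B)%E.
Proof. by rewrite mule_ge0// lee_fin out_prob_ge0. Qed.

Lemma blackwell0 : blackwell set0 = 0%E.
Proof. by rewrite /blackwell big1// => y _; rewrite measure0 mule0. Qed.

Lemma blackwell_ge0 B : (0 <= blackwell B)%E.
Proof. by apply: sume_ge0 => y _; exact: blackwell_term_ge0. Qed.

Lemma blackwell_sigma_additive : semi_sigma_additive blackwell.
Proof.
move=> F mF tF mUF.
have -> : blackwell (\bigcup_n F n) = (\sum_(0 <= n <oo) blackwell (F n))%E.
  rewrite /blackwell nneseries_sum => [|y n _]; last exact: blackwell_term_ge0.
  apply: eq_bigr => y _; rewrite nneseriesZl//.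
  by rewrite measure_semi_bigcup.
by apply: is_cvg_nneseries => n _ _; exact: blackwell_ge0.
Qed.

HB.instance Definition _ :=
  isMeasure.Build _ _ _ blackwell blackwell0 blackwell_ge0
    blackwell_sigma_additive.

Lemma blackwell_setT : blackwell setT = 1%E.
Proof.
rewrite /blackwell; under eq_bigr do rewrite diracT mule1.
rewrite sumEFin; congr (_%:E).
have -> : \sum_(y : channel_im) out_prob (val y) =
    \sum_(y | 0 < out_prob y) out_prob y.
  rewrite (reindex_omap (val : channel_im -> Y) insub) => [|y y0].
    apply: eq_bigl => y; rewrite (valP y) valK eqxx.
    by [].
  by rewrite insubT.
rewrite -out_prob_sum [RHS](bigID (fun y => 0 < out_prob y))/=.
rewrite [X in _ + X]big1 ?addr0// => y; rewrite -leNgt => y0.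
by apply/le_anti; rewrite y0 out_prob_ge0.
Qed.

HB.instance Definition _ :=
  Measure_isProbability.Build _ _ _ blackwell blackwell_setT.

End measure_of_channel.
End blackwell.

Section total_variation.
Context d (T : measurableType d).
Implicit Types mu nu : probability T R.

Definition tv_dist mu nu : R :=
  sup [set `|fine (mu B) - fine (nu B)| | B in measurable].

Lemma tv_dist_has_sup mu nu :
  has_sup [set `|fine (mu B) - fine (nu B)| | B in measurable].
Proof.
split; first by exists `|fine (mu set0) - fine (nu set0)|, set0.
have fine01 (m : probability T R) B : measurable B -> 0 <= fine (m B) <= 1.
  move=> mB; rewrite fine_ge0//= -lee_fin fineK ?probability_le1//.
  exact: fin_num_measure.
exists 1 => _ [B mB <-].
have /andP[a0 a1] := fine01 mu B mB; have /andP[b0 b1] := fine01 nu B mB.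
by rewrite ler_norml; apply/andP; split; lra.
Qed.

Lemma tv_dist_ge mu nu B : measurable B ->
  `|fine (mu B) - fine (nu B)| <= tv_dist mu nu.
Proof. by move=> mB; apply: sup_upper_bound; [exact: tv_dist_has_sup|exists B]. Qed.

Lemma tv_dist_le mu nu e :
  (forall B, measurable B -> `|fine (mu B) - fine (nu B)| <= e) ->
  tv_dist mu nu <= e.
Proof.
move=> le_e; apply: ge_sup; first by have [] := tv_dist_has_sup mu nu.
by move=> _ [B mB <-]; exact: le_e.
Qed.

Lemma tv_distxx mu : tv_dist mu mu = 0.
Proof.
apply/le_anti/andP; split.
  by apply: tv_dist_le => B _; rewrite subrr normr0.
exact: le_trans (normr_ge0 _) (tv_dist_ge mu mu measurable0).
Qed.

Lemma tv_dist_sym mu nu : tv_dist mu nu = tv_dist nu mu.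
Proof.
by rewrite /tv_dist; congr sup; apply: eq_imagel => B _; rewrite distrC.
Qed.

Lemma tv_dist_triangle nu mu rho :
  tv_dist mu rho <= tv_dist mu nu + tv_dist nu rho.
Proof.
apply: tv_dist_le => B mB; apply: le_trans (ler_distD (fine (nu B)) _ _) _.
by rewrite lerD ?tv_dist_ge.
Qed.

End total_variation.

Section tv_topology.
Variables (X : finType) (hX : (0 < #|X|)%N).

(* Equivalent channels have the same Blackwell measure, so the choice of the
   representative is immaterial. *)
Definition blackwell_star (w : dmco_star X) : probability (borel_simplex hX) R :=
  blackwell (projT2 (repr w)).

Definition dmco_star_tv of (0 < #|X|)%N : Type := dmco_star X.
HB.instance Definition _ := Choice.on (dmco_star_tv hX).

Definition dtv (w w' : dmco_star_tv hX) : R :=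
  tv_dist (blackwell_star w) (blackwell_star w').

Definition dtv_ball (w : dmco_star_tv hX) (e : R) : set (dmco_star_tv hX) :=
  [set w' | dtv w w' < e].

Lemma dtv_ball_center w (e : R) : 0 < e -> dtv_ball w e w.
Proof. by rewrite /dtv_ball/= /dtv tv_distxx. Qed.

Lemma dtv_ball_sym w w' (e : R) : dtv_ball w e w' -> dtv_ball w' e w.
Proof. by rewrite /dtv_ball/= /dtv tv_dist_sym. Qed.

Lemma dtv_ball_triangle w1 w2 w3 (e1 e2 : R) :
  dtv_ball w1 e1 w2 -> dtv_ball w2 e2 w3 -> dtv_ball w1 (e1 + e2) w3.
Proof.
move=> h1 h2; apply: le_lt_trans (ltrD h1 h2); exact: tv_dist_triangle.
Qed.

(* Only the balls matter for the topology, so a pseudometric structure is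
   enough even though the distance is in fact a metric. *)
HB.instance Definition _ :=
  hasNbhs.Build (dmco_star_tv hX) (nbhs_ (entourage_ dtv_ball)).
HB.instance Definition _ :=
  @Nbhs_isPseudoMetric.Build R (dmco_star_tv hX) (entourage_ dtv_ball) erefl
    dtv_ball dtv_ball_center dtv_ball_sym dtv_ball_triangle erefl.

Definition tv_topology : Topological (dmco_star X) :=
  Topological.class (dmco_star_tv hX).

End tv_topology.

End channels.

(* Main.v *)
(* Let W_t send x0 to the outputs 0 and 1 with probabilities 1 - t and t, and
   every other input to the output 1.  Then W_t tends to W_0 entrywise as t
   tends to 0.  Consider the closed face p(x0) = 0 of the simplex.  For t > 0 an
   output that x0 cannot produce through a channel degraded from W_t has
   probability 0 for every input, so the Blackwell measure gives mass 0 to the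
   face.  On the other hand, a channel from which W_0 is degraded must separate
   x0 from the other inputs, so its Blackwell measure gives mass at least 1/|X|
   to the face.  These arguments only use degradedness, so they apply to any
   representative of the classes, and the classes of W_t stay at total-variation
   distance at least 1/|X| from that of W_0, although they converge to it in the
   quotient topology. *)

Require Import Defs.
From mathcomp Require Import all_boot all_order all_algebra.
From mathcomp Require Import all_classical all_reals all_analysis.
From mathcomp Require Import generic_quotient lra.

Set Implicit Arguments.
Unset Strict Implicit.
Unset Printing Implicit Defensive.

Import Order.TTheory GRing.Theory Num.Theory.
Import numFieldNormedType.Exports.

Local Open Scope classical_set_scope.
Local Open Scope ring_scope.
Local Open Scope quotient_scope.

(** The product topology is the supremum of the topologies pulled back along the evaluations, and
    constant functions make each evaluation surjective. *)
Lemma ptws_cvg (R : realType) (I : Type) (u : nat -> {ptws I -> R})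
    (f : {ptws I -> R}) :
  (forall i, (fun n => u n i) @ \oo --> f i) -> u @ \oo --> f.
Proof.
move=> uf; apply/cvg_sup => i; rewrite cvg_image; last first.
  by rewrite eqEsubset; split=> v // _; exists (cst v).
move=> A /= /uf uA; exists (@^~ i @^-1` A) => //.
by rewrite eqEsubset; split => [j [? + <-//]|j Aj]; exists (fun=> j).
Qed.

Lemma set_val_cvg (T : topologicalType) (A : set T) (u : nat -> A) (a : A) :
  (fun n => set_val (u n)) @ \oo --> set_val a -> u @ \oo --> a.
Proof.
move=> ua U [_ [[B oB <-] Ba] BU].
have /ua : nbhs (set_val a) B by exact: open_nbhs_nbhs.
case=> N _ uN; exists N => // n Nn; apply: BU; exact: uN.
Qed.

Lemma channel_cvg (R : realType) (X Y : finType) (u : nat -> channel R X Y)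
    (W : channel R X Y) :
  (forall x y, (fun n => kern (u n) x y) @ \oo --> kern W x y) -> u @ \oo --> W.
Proof.
by move=> uW; apply: set_val_cvg; apply: ptws_cvg => -[x y]; exact: uW.
Qed.

Section vanishing_posterior.
Variables (R : realType) (X : finType) (hX : (0 < #|X|)%N) (x0 : X).

Definition simplex_face : set (borel_simplex R hX) := [set p | set_val p x0 = 0].

(** The complement is open, as the preimage of the nonzero reals under a continuous coordinate. *)
Lemma measurable_simplex_face : measurable simplex_face.
Proof.
rewrite -[simplex_face]setCK; apply: measurableC; apply: sub_sigma_algebra.
have -> : ~` simplex_face =
    (set_val : simplex R hX -> {ptws X -> R}) @^-1`
      ((proj x0 : {ptws X -> R} -> R) @^-1` [set~ 0]) by [].
eexists; last reflexivity.
apply: open_comp => [f _|]; first exact: (@proj_continuous X (fun=> R) x0).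
by apply: closed_openC; exact: closed_eq.
Qed.

(** The atom at the posterior of [y] lies on the face exactly when [kern W x0 y] vanishes; outputs
    outside the image of [W] add only zero terms. *)
Lemma blackwell_simplex_face (Y : finType) (W : channel R X Y) :
  fine (blackwell W simplex_face) =
  \sum_(y | kern W x0 y == 0) out_prob W y.
Proof.
have faceE (y : channel_im W) :
    simplex_face (posterior hX y) <-> kern W x0 (val y) = 0.
  have -> : simplex_face (posterior hX y) =
      (kern W x0 (val y) / (#|X|%:R * out_prob W (val y)) = 0) by [].
  split=> [/eqP|->]; last by rewrite mul0r.
  rewrite mulf_eq0 => /orP[/eqP//|].
  rewrite invr_eq0 mulf_eq0 (negbTE (cardX_neq0 _ hX)) /=.
  by move: (valP y) => /[swap] /eqP ->; rewrite ltxx.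
have -> : blackwell W simplex_face =
    (\sum_(y : channel_im W | kern W x0 (val y) == 0%R) (out_prob W (val y))%:E)%E.
  rewrite /blackwell [RHS]big_mkcond/=; apply: eq_bigr => y _.
  rewrite diracE; case: eqP => [/faceE y0|y0].
    by rewrite mem_set// mule1.
  by rewrite memNset ?mule0// => /faceE.
rewrite sumEFin/= [RHS](bigID (fun y => 0 < out_prob W y))/=.
rewrite [X in _ = _ + X]big1 ?addr0; last first.
  move=> y /andP[_]; rewrite -leNgt => y0.
  by apply/le_anti; rewrite y0 out_prob_ge0.
rewrite [RHS](reindex_omap (val : channel_im W -> Y) insub) => [|y /andP[_ y0]].
  by apply: eq_bigl => y; rewrite (valP y) valK eqxx !andbT.
by rewrite insubT.
Qed.

Lemma blackwell_simplex_face0 (Y : finType) (W : channel R X Y) :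
  (forall y, kern W x0 y = 0 -> forall x, kern W x y = 0) ->
  fine (blackwell W simplex_face) = 0.
Proof.
move=> W0; rewrite blackwell_simplex_face big1// => y /eqP/W0 y0.
by rewrite /out_prob big1 ?mulr0.
Qed.

End vanishing_posterior.

Section z_channel.
Variables (R : realType) (X : finType) (x0 : X).

Section kernel.
Variables (t : R) (t01 : 0 <= t <= 1).

Definition z_kern (x : X) (y : 'I_2) : R :=
  if x == x0 then (if y == ord0 then 1 - t else t) else (y != ord0)%:R.

Lemma z_kern_ge0 x y : 0 <= z_kern x y.
Proof.
have /andP[t0 t1] := t01.
rewrite /z_kern; case: ifP => _; last exact: ler0n.
by case: ifP => _ //; rewrite subr_ge0.
Qed.

Lemma z_kern_sum x : \sum_y z_kern x y = 1.
Proof.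
rewrite big_ord_recl big_ord1 /z_kern eqxx /=.
by case: ifP => _; rewrite ?add0r// subrK.
Qed.

Definition z_channel : channel R X 'I_2 := mk_channel z_kern_ge0 z_kern_sum.

Lemma degraded_z_channel_eq0 (Y : finType) (W : channel R X Y) :
  0 < t -> degraded W z_channel ->
  forall y, kern W x0 y = 0 -> forall x, kern W x y = 0.
Proof.
move=> t0 [V ->] y; rewrite kern_mk /comp_kern kern_mk => Vy0 x.
have V_ge0 i : 0 <= kern V i y by have /andP[] := (kernP V).1 i y.
move: Vy0; rewrite 2!big_ord_recl !big_ord0 /z_kern !eqxx /= !addr0.
(* Here [a * (1 - t) + b * t = 0] with both terms nonnegative and [t > 0], so [b = 0]; inputs other
   than [x0] reach [y] only with probability [b]. *)
set a := kern V _ y; set b := kern V _ y => ab0.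
have a0 : 0 <= a * (1 - t).
  by apply: mulr_ge0; [exact: V_ge0|rewrite subr_ge0; have /andP[] := t01].
have b0 : b = 0.
  have : b * t <= 0 by lra.
  rewrite pmulr_lle0// => b0; apply/le_anti; rewrite b0; exact: V_ge0.
rewrite 2!big_ord_recl big_ord0 /= -/b b0 mul0r !addr0.
by case: ifP => _; rewrite ?mulr0//; move: ab0; rewrite b0 mul0r addr0.
Qed.

End kernel.

Lemma blackwell_simplex_face_ge (hX : (0 < #|X|)%N) (x1 : X) (Y : finType)
    (t01 : 0 <= (0 : R) <= 1) (W : channel R X Y) :
  x1 != x0 -> degraded (z_channel t01) W ->
  #|X|%:R^-1 <= fine (blackwell W (simplex_face x0 : set (borel_simplex R hX))).
Proof.
move=> x10 [U WU].
have UE x : kern (z_channel t01) x ord_max = \sum_y kern U y ord_max * kern W x y.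
  by rewrite WU.
have U_ge0 y x : 0 <= kern U y ord_max * kern W x y.
  by have [/andP[? _] /andP[? _]] := ((kernP U).1 y ord_max, (kernP W).1 x y);
     rewrite mulr_ge0.
(* Given [x0], the output [ord_max] has probability 0, so every nonnegative term of its sum
   vanishes. *)
have U0 y : kern W x0 y != 0 -> kern U y ord_max = 0.
  have := UE x0; rewrite kern_mk /z_kern eqxx /= => /esym UW0.
  have /eqP : kern U y ord_max * kern W x0 y = 0.
    by apply: (psumr_eq0P _ UW0) => // z _; exact: U_ge0.
  by rewrite mulf_eq0 => /orP[/eqP//|->].
rewrite blackwell_simplex_face /out_prob -mulr_sumr ler_peMr ?invr_ge0//.
have W_ge0 x y : 0 <= kern W x y by have /andP[] := (kernP W).1 x y.
(* Among the inputs, [x1] alone suffices: it yields [ord_max] with probability 1, and only through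
   outputs [y] that [x0] cannot produce. *)
apply: (@le_trans _ _ (\sum_(y | kern W x0 y == 0) kern W x1 y)); last first.
  apply: ler_sum => y _; rewrite (bigD1 x1)//= lerDl; exact: sumr_ge0.
have <- : kern (z_channel t01) x1 ord_max = 1.
  by rewrite kern_mk /z_kern (negbTE x10).
rewrite UE (bigID (fun y => kern W x0 y == 0))/=.
rewrite [X in _ + X]big1 ?addr0; last by move=> y /U0 ->; rewrite mul0r.
apply: ler_sum => y _; rewrite ler_piMl//.
by have /andP[] := (kernP U).1 y ord_max.
Qed.

End z_channel.

Theorem corollary11 (R : realType) (X : finType) (hX : (1 < #|X|)%N) :
  ~ natural_topology (tv_topology R (ltnW hX)).
Proof.
move=> nat_tv.
have [x0 [x1 [_ _ x01]]] := card_gt1P hX.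
have x10 : x1 != x0 by rewrite eq_sym.
have z01 : 0 <= (0 : R) <= 1 by rewrite lexx ler01.
have h01 n : 0 <= (harmonic n : R) <= 1.
  by rewrite invr_ge0 ler0n invf_le1 ?ler1n.
pose T := dmco_star_tv R (ltnW hX).
pose cls (W : channel R X 'I_2) : T := dmco_incl (\pi_(dmco R X 'I_2) W).
have cls_equiv W : channel_equiv (projT2 (repr (cls W : dmco_star R X))) W.
  rewrite /cls dmco_incl_pi.
  pose w : channel_star R X := existT (fun n => channel R X 'I_n.+1) 1%N W.
  have e : \pi_{eq_quot (@equiv_star R X)} (repr (\pi_(dmco_star R X) w)) = \pi w.
    exact: reprK.
  by move/eqmodP/asboolP : e.
pose W0 := z_channel x0 z01.
(* The parameter [harmonic n], which is 1/(n+1), tends to 0 but stays positive. *)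
pose Wn n := z_channel x0 (h01 n).
have WnW0 : Wn @ \oo --> W0.
  apply: channel_cvg => x y.
  change ((fun n => z_kern x0 (harmonic n : R) x y) @ \oo --> z_kern x0 0 x y).
  rewrite /z_kern.
  case: (x == x0); last exact: cvg_cst.
  case: (y == ord0); last exact: cvg_harmonic.
  by apply: cvgB; [exact: cvg_cst|exact: cvg_harmonic].
pose e : R := #|X|%:R^-1.
have e0 : 0 < e by rewrite invr_gt0 ltr0n ltnW.
pose A : set T := (ball (cls W0) e)°.
have oA : open (@dmco_incl R X 1 @^-1` A).
  (* Naturality is used at index 1, the two-letter output alphabet ['I_2]. *)
  by rewrite nat_tv; exists A => //; exact: open_interior.
have A0 : A (cls W0) by apply: nbhsx_ballx.
have : nbhs W0 (\pi_(dmco R X 'I_2) @^-1` (@dmco_incl R X 1 @^-1` A)).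
  by apply: open_nbhs_nbhs; split.
(* A single term [Wn N] whose class lies in the ball is enough for the contradiction. *)
move=> /WnW0 [N _ /(_ N (leqnn N))] /interior_subset.
apply/negP; rewrite -leNgt.
have [_ dW0] := cls_equiv W0; have [dWn _] := cls_equiv (Wn N).
pose F : set (borel_simplex R (ltnW hX)) := simplex_face x0.
have mF : measurable F by exact: measurable_simplex_face.
apply: le_trans (tv_dist_ge (blackwell_star _ (cls W0))
                            (blackwell_star _ (cls (Wn N))) mF).
have -> : fine (blackwell_star (ltnW hX) (cls (Wn N)) F) = 0.
  apply: blackwell_simplex_face0; apply: degraded_z_channel_eq0 dWn.
  by rewrite invr_gt0.
rewrite subr0; apply: le_trans (ler_norm _).
exact: blackwell_simplex_face_ge x10 dW0.
Qed.
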